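(* Let $V$ be a complex Hilbert space of dimension at least $2$, and consider the group $G:=\{\omega\cdot\operatorname{id}:\omega\in\mathbb{C},\ |\omega|=1\}\leq U(V)$. Then $c_2(V/G)=\sqrt{2}$.
   Context: $V/G$ is the set of orbits $[x]=G\cdot x$, $x\in V$, with metric $d([x],[y])=\inf_{|\omega|=1}\|\omega x-y\|$. The Euclidean distortion $c_2(X)\in[1,\infty]$ of a metric space $X$ is the infimum of all $c$ for which there exist a Hilbert space $H$, a map $f\colon X\to H$ and a constant $\alpha>0$ such that $\alpha\, d_X(x,x')\leq\|f(x)-f(x')\|\leq c\,\alpha\, d_X(x,x')$ for all $x,x'\in X$ (that is, $f$ is bilipschitz of distortion at most $c$, where distortion is the ratio of the optimal upper to lower Lipschitz bounds). *)

(* Defs.v *)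
From HB Require Import structures.
From mathcomp Require Import all_boot all_order all_algebra.
From mathcomp Require Import complex.
From mathcomp Require Import all_classical all_reals all_analysis.
Set Implicit Arguments.
Unset Strict Implicit.
Unset Printing Implicit Defensive.
Import Order.TTheory GRing.Theory Num.Theory.
Import numFieldNormedType.Exports.
Local Open Scope classical_set_scope.
Local Open Scope ring_scope.

(* Hilbert spaces: [theta] is the conjugation of the scalar field [K],
   i.e. [idfun] for [K = R] and [Num.conj] for [K = R[i]]. Following the
   library, forms are linear in the first argument. *)
Record hilbertType (K : numFieldType) (theta : K -> K) := HilbertType {
  hilbert_sort :> completeNormedModType K ;
  dotv : {dot hilbert_sort for theta} ;
  dotvE : forall x : hilbert_sort, dotv x x = `|x| ^+ 2 }.

Arguments dotv {K theta} h.

Definition real_hilbertType (R : realType) := hilbertType (@idfun R).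
Definition complex_hilbertType (R : realType) := hilbertType (@Num.conj R[i]).

(* Algebraic dimension, possibly infinite. *)
Definition dim_geq (K : numFieldType) (V : lmodType K) (n : nat) : Prop :=
  exists e : 'I_n -> V,
    forall c : 'I_n -> K, \sum_i c i *: e i = 0 -> forall i, c i = 0.

(* The condition [1 <= c] only matters for spaces with at most one point,
   where the Lipschitz bounds are vacuous. *)
Definition euclidean_distortion (R : realType) (X : metricType R) : \bar R :=
  ereal_inf [set c%:E | c in [set c : R | 1 <= c /\
    exists (H : real_hilbertType R) (f : X -> H) (alpha : R), 0 < alpha /\
      forall x y : X,
        alpha * mdist x y <= `|f x - f y| /\
        `|f x - f y| <= c * alpha * mdist x y]].

Lemma optimal_rotation (C : numClosedFieldType)
    (V : hilbertType (@Num.conj C)) (x y : V) :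
  exists2 w : C, `|w| = 1 &
    forall u : C, `|u| = 1 -> `|w *: x - y| <= `|u *: x - y|.
Proof.
pose c := dotv V x y.
have [w w1 wc] : exists2 w : C, `|w| = 1 & w * c = `|c|.
  have [->|c0] := eqVneq c 0; first by exists 1; rewrite ?normr1// mul1r normr0.
  exists (`|c| / c); last by rewrite divfK.
  by rewrite normf_div normr_id divff// normr_eq0.
exists w => // u u1.
have normE (v : C) : `|v| = 1 ->
    `|v *: x - y| ^+ 2 = `|x| ^+ 2 + `|y| ^+ 2 - 2 * 'Re (v * c).
  move=> v1; rewrite -!dotvE dnormB dnormZ v1 expr1n mul1r; congr (_ - _).
  by rewrite linearZl_LR/= ReE [2 * _]mulrC divfK ?pnatr_eq0.
rewrite -(@ler_pXn2r _ 2) ?nnegrE// !normE// lerD2l lerN2 ler_pM2l ?ltr0n//.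
rewrite wc (Creal_ReP _ (normr_real _)).
rewrite (le_trans (real_ler_norm (Creal_Re _)))//.
rewrite (le_trans (leif_normC_Re_Creal _).1)//.
by rewrite normrM u1 mul1r.
Qed.

Section CircleQuotient.
Context {R : realType} (V : complex_hilbertType R).
Implicit Types (w : R[i]) (x y z : V).

Definition unit_circle : set R[i] := [set w | `|w| = 1].

Definition circle_group : set (V -> V) :=
  [set (fun x => w *: x) | w in unit_circle].

Definition circle_orbit (x : V) : set V := [set g x | g in circle_group].

Definition circle_quotient : Type := range circle_orbit.

HB.instance Definition _ :=
  Choice.copy circle_quotient (set_type (range circle_orbit)).

Definition circle_class (x : V) : circle_quotient :=
  SigSub (mem_set (imageT circle_orbit x)).

Lemma circle_repr_subproof (X : circle_quotient) :
  exists x, X = circle_class x.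
Proof.
case: X => O OP; have [x _ xO] := set_mem OP.
by exists x; apply: val_inj => /=.
Qed.

Definition circle_repr (X : circle_quotient) : V :=
  sval (cid (circle_repr_subproof X)).

Lemma circle_reprK : cancel circle_repr circle_class.
Proof. by move=> X; rewrite /circle_repr; case: cid. Qed.

(* Norms in [V] are elements of [R[i]]; [Re] brings them back to [R]. *)
Definition rotation_dist (x y : V) : R :=
  inf [set complex.Re `|w *: x - y| | w in unit_circle].


Lemma Re_normv (v : V) : (complex.Re `|v|)%:C%C = `|v|.
Proof. by rewrite RRe_real. Qed.

Lemma rotation_dist_le (w : R[i]) x y : `|w| = 1 ->
  rotation_dist x y <= complex.Re `|w *: x - y|.
Proof.
move=> w1; apply: ge_inf; last by exists w.
by exists 0 => _ [u _ <-]; rewrite -lecR Re_normv; exact: normr_ge0.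
Qed.

Lemma rotation_dist_attained x y :
  exists2 w : R[i], `|w| = 1 & rotation_dist x y = complex.Re `|w *: x - y|.
Proof.
have [w w1 wmin] := optimal_rotation x y.
exists w => //; apply/eqP; rewrite eq_le rotation_dist_le//=.
apply: lb_le_inf.
  by exists (complex.Re `|1 *: x - y|), 1 => //=; exact: normr1.
by move=> _ [u u1 <-]; rewrite -lecR !Re_normv; exact: wmin.
Qed.

Lemma rotation_dist_ge0 x y : 0 <= rotation_dist x y.
Proof.
have [w _ ->] := rotation_dist_attained x y.
by rewrite -lecR Re_normv; exact: normr_ge0.
Qed.

Lemma rotation_distxx x : rotation_dist x x = 0.
Proof.
apply/eqP; rewrite eq_le rotation_dist_ge0 andbT.
rewrite (le_trans (rotation_dist_le x x (normr1 _)))//.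
by rewrite scale1r subrr normr0.
Qed.

Lemma rotation_dist_le_rot (u v : R[i]) x y : `|u| = 1 -> `|v| = 1 ->
  rotation_dist (u *: x) (v *: y) <= rotation_dist x y.
Proof.
move=> u1 v1; have [w w1 ->] := rotation_dist_attained x y.
have u0 : u != 0 by rewrite -normr_eq0 u1 oner_eq0.
have vwu1 : `|v * w / u| = 1 by rewrite !normrM normfV u1 v1 w1 !mul1r invr1.
rewrite (le_trans (rotation_dist_le _ _ vwu1))// scalerA divfK//.
by rewrite -scalerA -scalerBr normrZ v1 mul1r.
Qed.

Lemma rotation_dist_rot (u v : R[i]) x y : `|u| = 1 -> `|v| = 1 ->
  rotation_dist (u *: x) (v *: y) = rotation_dist x y.
Proof.
move=> u1 v1; apply/eqP; rewrite eq_le rotation_dist_le_rot//=.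
have norm1V (w : R[i]) : `|w| = 1 -> `|w^-1| = 1.
  by move=> w1; rewrite normfV w1 invr1.
have norm1_neq0 (w : R[i]) : `|w| = 1 -> w != 0.
  by move=> w1; rewrite -normr_eq0 w1 oner_eq0.
rewrite -{1}(scalerK (norm1_neq0 _ u1) x) -{1}(scalerK (norm1_neq0 _ v1) y).
by apply: rotation_dist_le_rot; exact: norm1V.
Qed.

Lemma rotation_dist_sym x y : rotation_dist x y = rotation_dist y x.
Proof.
suff le a b : rotation_dist a b <= rotation_dist b a.
  by apply/eqP; rewrite eq_le !le.
have [w w1 ->] := rotation_dist_attained b a.
rewrite -(rotation_dist_rot a b w1 (normr1 _)) scale1r.
have [v v1 vE] := rotation_dist_attained (w *: a) b.
have w0 : w != 0 by rewrite -normr_eq0 w1 oner_eq0.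
have wV1 : `|w^-1 / w| = 1 by rewrite normrM normfV w1 invr1 mulr1.
rewrite (le_trans (rotation_dist_le _ _ wV1))//.
rewrite scalerA divfK//.
have -> : `|w^-1 *: a - b| = `|w *: b - a|; last by [].
by rewrite -[RHS]mul1r -(invr1) -{1}w1 -normfV -normrZ scalerBr scalerK// distrC.
Qed.

Lemma rotation_dist_triangle y x z :
  rotation_dist x z <= rotation_dist x y + rotation_dist y z.
Proof.
have [w w1 ->] := rotation_dist_attained x y.
have [v v1 ->] := rotation_dist_attained y z.
have vw1 : `|v * w| = 1 by rewrite normrM v1 w1 mulr1.
rewrite (le_trans (rotation_dist_le _ _ vw1))//.
rewrite -lecR rmorphD/= !Re_normv -scalerA.
have -> : `|w *: x - y| = `|v *: (w *: x) - v *: y|.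
  by rewrite -scalerBr normrZ v1 mul1r.
exact: ler_distD.
Qed.

Lemma circle_classP x y :
  circle_class x = circle_class y <-> exists2 w : R[i], `|w| = 1 & w *: x = y.
Proof.
split=> [/(congr1 val)/= xy|[w w1 <-]].
  have : circle_orbit y y.
    exists (fun z => 1 *: z); last by rewrite /= scale1r.
    by exists 1 => //; exact: normr1.
  by rewrite -xy => -[_ [w w1 <-] <-]; exists w.
apply: val_inj => /=; have w0 : w != 0 by rewrite -normr_eq0 w1 oner_eq0.
apply/seteqP; split => _ [_ [u u1 <-] <-].
- exists (fun z => (u / w) *: z); last by rewrite /= scalerA divfK.
  by exists (u / w) => //=; rewrite /unit_circle/= normrM normfV u1 w1 divr1.
- exists (fun z => (u * w) *: z); last by rewrite /= scalerA.
  by exists (u * w) => //=; rewrite /unit_circle/= normrM u1 w1 mulr1.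
Qed.

(* The choice of representatives is irrelevant, see [circle_distE]. *)
Definition circle_dist (X Y : circle_quotient) : R :=
  rotation_dist (circle_repr X) (circle_repr Y).

Lemma circle_distE x y :
  circle_dist (circle_class x) (circle_class y) =
  inf [set complex.Re `|w *: x - y| | w in unit_circle].
Proof.
have rot z : exists2 w : R[i], `|w| = 1 & w *: z = circle_repr (circle_class z).
  by apply/circle_classP; rewrite circle_reprK.
have [u u1 ux] := rot x; have [v v1 vy] := rot y.
by rewrite /circle_dist -ux -vy rotation_dist_rot.
Qed.

Lemma circle_distxx X : circle_dist X X = 0.
Proof. exact: rotation_distxx. Qed.

Lemma circle_dist_sym X Y : circle_dist X Y = circle_dist Y X.
Proof. exact: rotation_dist_sym. Qed.

Lemma circle_dist_triangle Y X Z :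
  circle_dist X Z <= circle_dist X Y + circle_dist Y Z.
Proof. exact: rotation_dist_triangle. Qed.

Lemma circle_dist_positivity X Y : circle_dist X Y = 0 -> X = Y.
Proof.
rewrite /circle_dist => XY0; rewrite -[X]circle_reprK -[Y]circle_reprK.
have [w w1 wE] := rotation_dist_attained (circle_repr X) (circle_repr Y).
apply/circle_classP; exists w => //.
apply/eqP; rewrite -subr_eq0 -normr_eq0 -Re_normv -wE XY0.
by [].
Qed.

HB.instance Definition _ := @isMetric.Build R circle_quotient circle_dist
  circle_distxx circle_dist_positivity circle_dist_sym circle_dist_triangle.

Lemma circle_mdistE x y :
  mdist (circle_class x) (circle_class y) =
  inf [set complex.Re `|w *: x - y| | w in unit_circle].
Proof. exact: circle_distE. Qed.

End CircleQuotient.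

Arguments circle_quotient {R} V.

(* Main.v *)
Require Import Defs.
From HB Require Import structures.
From mathcomp Require Import all_boot all_order all_algebra.
From mathcomp Require Import complex.
From mathcomp Require Import all_classical all_reals all_analysis.
From mathcomp Require Import ring lra.

(* Upper bound: x |-> (x tensor conj x) / |x| descends to V/G, and with a = |x|,
   b = |y|, s = |<x, y>| one has |f x - f y|^2 = a^2 + b^2 - 2 s^2 / (a b), which lies
   between d^2 = a^2 + b^2 - 2 s and 2 d^2 because 0 <= s <= a b. Instead of
   Hilbert-Schmidt operators, the target is the reproducing kernel Hilbert space
   of the kernel |<x, y>|^2 / (|x| |y|). Its squared norm is the Legendre
   transform sup_e (2 g(e) - |e|^2) over finite combinations e of points; in
   this form the parallelogram law for sups is an identity between the terms.

   Lower bound: on the great circle x_k = cos (k pi / n) u + sin (k pi / n) v,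
   u and v orthonormal, with n = 2^(p + 2), the class of x_k is n-periodic in k,
   classes half a period apart are at distance sqrt 2, and consecutive ones at
   squared distance 2 - 2 cos (pi / n). The sharp Poincare inequality on the
   n-cycle for Hilbert-valued functions, comparing half-period differences with
   consecutive ones, gives c^2 >= 1 + cos (pi / n), and n goes to infinity. *)

Set Implicit Arguments.
Unset Strict Implicit.
Unset Printing Implicit Defensive.
Import Order.TTheory GRing.Theory Num.Theory.
Import numFieldNormedType.Exports.
Local Open Scope classical_set_scope.
Local Open Scope ring_scope.

(** * Functionals on finite combinations of points *)

Section LinearCombinations.
Context {R : realType} {X : Type}.
Implicit Types (g h : X -> R) (e : seq (R * X)) (K : X -> X -> R).

Definition lincomb g e : R := \sum_(p <- e) p.1 * g p.2.

Definition comb (a : R) e1 (b : R) e2 : seq (R * X) :=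
  [seq (a * p.1, p.2) | p <- e1] ++ [seq (b * p.1, p.2) | p <- e2].

Lemma lincomb_comb g a e1 b e2 :
  lincomb g (comb a e1 b e2) = a * lincomb g e1 + b * lincomb g e2.
Proof.
rewrite /lincomb big_cat !big_map !big_distrr /=.
by congr (_ + _); apply: eq_bigr => p _; rewrite mulrA.
Qed.

Lemma lincombD g h e : lincomb (g + h) e = lincomb g e + lincomb h e.
Proof. by rewrite -big_split; apply: eq_bigr => p _; rewrite mulrDr. Qed.

Lemma lincombZ a g e : lincomb (a *: g) e = a * lincomb g e.
Proof. by rewrite big_distrr; apply: eq_bigr => p _; rewrite /= mulrCA. Qed.

Lemma lincombB g h e : lincomb (g - h) e = lincomb g e - lincomb h e.
Proof. by rewrite lincombD -scaleN1r lincombZ mulN1r. Qed.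

Definition cross K e1 e2 : R := lincomb (fun x => lincomb (K x) e2) e1.

Lemma cross_combl K a e1 b e2 e :
  cross K (comb a e1 b e2) e = a * cross K e1 e + b * cross K e2 e.
Proof. exact: lincomb_comb. Qed.

Lemma cross_combr K a e1 b e2 e :
  cross K e (comb a e1 b e2) = a * cross K e e1 + b * cross K e e2.
Proof.
rewrite /cross -!lincombZ -lincombD; congr lincomb.
by apply/funext => x; rewrite lincomb_comb.
Qed.

Lemma crossC K : (forall x y, K x y = K y x) ->
  forall e1 e2, cross K e1 e2 = cross K e2 e1.
Proof.
move=> Ksym e1 e2; rewrite /cross /lincomb.
under eq_bigr do rewrite big_distrr/=.
rewrite exchange_big; apply: eq_bigr => p _.
by rewrite big_distrr; apply: eq_bigr => q _; rewrite /= Ksym mulrCA.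
Qed.

End LinearCombinations.

Record psdKernel (R : realType) (X : Type) := PsdKernel {
  kernel_fun :> X -> X -> R ;
  kernelC : forall x y, kernel_fun x y = kernel_fun y x ;
  kernel_ge0 : forall e, 0 <= cross kernel_fun e e }.

(** * The Legendre transform of the squared seminorm *)

Section Legendre.
Context {R : realType} {X : Type} (K : psdKernel R X).
Implicit Types (g h : X -> R) (e : seq (R * X)).

(* The supremum over [e] is the squared norm of [g] as a functional on finite
   combinations of points with the seminorm [sqrt (cross K e e)]. *)
Definition legendre g e : R := 2 * lincomb g e - cross K e e.

(** Membership in the future Hilbert space: where it fails, the supremum in [sqn] only returns a
    default value. *)
Definition sqbounded g : Prop := exists M, forall e, legendre g e <= M.

Definition sqn g : R := sup (range (legendre g)).

Lemma sqn_sup g : sqbounded g -> has_sup (range (legendre g)).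
Proof.
by case=> M gM; split; [exists (legendre g [::]), [::]|exists M => _ [e _ <-]].
Qed.

Lemma legendre_le_sqn g e : sqbounded g -> legendre g e <= sqn g.
Proof. by move=> /sqn_sup[_ ?]; apply: ub_le_sup => //; exists e. Qed.

Lemma sqn_le g M : (forall e, legendre g e <= M) -> sqn g <= M.
Proof.
by move=> gM; apply: ge_sup => [|_ [e _ <-]//]; exists (legendre g [::]), [::].
Qed.

(** The two suprema are taken one after the other, dividing by the positive weights. This lifts
    relations between terms to inequalities between suprema. *)
Lemma sqn_le2 g h (a b M : R) : 0 < a -> 0 < b ->
  (forall e1 e2, a * legendre g e1 + b * legendre h e2 <= M) ->
  a * sqn g + b * sqn h <= M.
Proof.
move=> a0 b0 ghM; rewrite -lerBrDr -ler_pdivlMl//.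
apply: sqn_le => e1; rewrite ler_pdivlMl// lerBrDr addrC -lerBrDr.
rewrite -ler_pdivlMl//; apply: sqn_le => e2.
by rewrite ler_pdivlMl// lerBrDr addrC.
Qed.

(** The quadratic parts obey the parallelogram law of the form [cross]; in the linear parts the
    mixed values [g e2] and [h e1] cancel. *)
Lemma legendre_parallelogram g h e1 e2 :
  legendre (g + h) (comb 1 e1 1 e2) + legendre (g - h) (comb 1 e1 (- 1) e2) =
  2 * legendre g e1 + 2 * legendre h e2.
Proof.
rewrite /legendre !lincombB !lincombD !lincomb_comb !cross_combl !cross_combr.
by rewrite (crossC (@kernelC _ _ K) e2 e1); ring.
Qed.

(* The vectors [u] and [v] below satisfy [u + v = e1 + e2],
   [u - t v = t e2 - e1] and [|u|^2 + t |v|^2 = |e1|^2 + t |e2|^2]. *)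
Lemma legendre_scale (t : R) g h e1 e2 : 0 < t ->
  exists u v, legendre (t *: g + h) u + t * legendre (g - h) v =
              legendre (t *: g - h) e1 + t * legendre (g + h) e2.
Proof.
move=> t0; have t1 : 1 + t != 0 by rewrite gt_eqF// ltr_pDl.
exists (comb ((t - 1) / (1 + t)) e1 (2 * t / (1 + t)) e2).
exists (comb (2 / (1 + t)) e1 ((1 - t) / (1 + t)) e2).
rewrite /legendre !lincombB !lincombD !lincombZ !lincomb_comb.
rewrite !cross_combl !cross_combr (crossC (@kernelC _ _ K) e2 e1).
by field.
Qed.

Lemma sqboundedD g h : sqbounded g -> sqbounded h -> sqbounded (g + h).
Proof.
move=> [M gM] [N hN]; exists (2 * M + 2 * N) => e.
(* [comb 2^-1 e 0 [::]] encodes [e / 2]. With both arguments equal to it, their sum acts as [e] and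
   their difference as zero. *)
have /= := legendre_parallelogram g h (comb 2^-1 e 0 [::]) (comb 2^-1 e 0 [::]).
have := gM (comb 2^-1 e 0 [::]); have := hN (comb 2^-1 e 0 [::]).
have := @kernel_ge0 _ _ K.
rewrite /legendre !lincombB !lincombD !lincomb_comb !cross_combl !cross_combr.
move=> /(_ e); lra.
Qed.

Lemma sqboundedZ a g : sqbounded g -> sqbounded (a *: g).
Proof.
move=> [M gM]; exists (M * a ^+ 2) => e.
have [->|a0] := eqVneq a 0.
  rewrite /legendre lincombZ expr0n mulr0 mul0r mulr0 sub0r oppr_le0.
  exact: kernel_ge0.
(* By scaling, [legendre (a *: g) e] is [a ^+ 2] times [legendre g] at [e / a]. *)
have := gM (comb a^-1 e 0 [::]).
rewrite -(ler_pM2r (_ : 0 < a ^+ 2)); last by rewrite exprn_even_gt0.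
apply: le_trans; rewrite /legendre lincombZ lincomb_comb cross_combl !cross_combr.
set A := lincomb _ [::]; set B := cross _ e [::].
set C := cross _ [::] _; set D := cross _ [::] _.
rewrite le_eqVlt; apply/orP; left; apply/eqP; field.
exact: a0.
Qed.

Lemma sqbounded0 : sqbounded 0.
Proof.
exists 0 => e; rewrite /legendre -[0](scale0r (0 : X -> R)) lincombZ mul0r mulr0.
by rewrite sub0r oppr_le0 kernel_ge0.
Qed.

Lemma sqn0 : sqn 0 = 0.
Proof.
apply/eqP; rewrite eq_le; apply/andP; split.
  apply: sqn_le => e.
  rewrite /legendre -[0](scale0r (0 : X -> R)) lincombZ mul0r mulr0.
  by rewrite sub0r oppr_le0 kernel_ge0.
apply: le_trans (legendre_le_sqn [::] sqbounded0).
by rewrite /legendre /cross /lincomb !big_nil mulr0 subr0.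
Qed.

Lemma sqn_ge0 g : sqbounded g -> 0 <= sqn g.
Proof.
move=> /(legendre_le_sqn [::]); apply: le_trans.
by rewrite /legendre /cross /lincomb !big_nil mulr0 subr0.
Qed.

Lemma sqboundedB g h : sqbounded g -> sqbounded h -> sqbounded (g - h).
Proof. by move=> gb hb; rewrite -scaleN1r; apply/sqboundedD/sqboundedZ. Qed.

Lemma sqn_parallelogram_ge g h : sqbounded g -> sqbounded h ->
  2 * sqn g + 2 * sqn h <= sqn (g + h) + sqn (g - h).
Proof.
move=> gb hb; apply: sqn_le2 => // e1 e2.
by rewrite -legendre_parallelogram lerD// legendre_le_sqn//;
  [exact: sqboundedD|exact: sqboundedB].
Qed.

Lemma sqn_double g : sqbounded g -> sqn (g + g) = 4 * sqn g.
Proof.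
move=> gb; apply/eqP; rewrite eq_le; apply/andP; split.
  apply: sqn_le => e.
  have := legendre_le_sqn (comb 2^-1 e 0 [::]) gb.
  rewrite -(ler_pM2l (_ : 0 < 4))//; apply: le_trans.
  rewrite /legendre lincombD lincomb_comb cross_combl !cross_combr.
  set A := lincomb _ [::]; set B := cross _ e [::].
  set C := cross _ [::] _; set D := cross _ [::] _.
  by lra.
have := sqn_parallelogram_ge gb gb; rewrite subrr sqn0; lra.
Qed.

(** The missing direction is [sqn_parallelogram_ge] applied to [g + h] and [g - h], whose sum and
    difference are [g + g] and [h + h]. *)
Lemma sqn_parallelogram g h : sqbounded g -> sqbounded h ->
  sqn (g + h) + sqn (g - h) = 2 * sqn g + 2 * sqn h.
Proof.
move=> gb hb; apply/eqP; rewrite eq_le sqn_parallelogram_ge// andbT.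
have := sqn_parallelogram_ge (sqboundedD gb hb) (sqboundedB gb hb).
have -> : g + h + (g - h) = g + g by rewrite addrACA subrr addr0.
have -> : g + h - (g - h) = h + h.
  by rewrite opprB [g + h]addrC addrACA subrr addr0.
by rewrite !sqn_double//; lra.
Qed.

(** Half of the positive homogeneity of the polarised form. Arguing on the terms yields all real
    [t > 0] at once, with no detour through rational scalars and continuity. *)
Lemma sqn_scale_le (t : R) g h : 0 < t -> sqbounded g -> sqbounded h ->
  sqn (t *: g - h) + t * sqn (g + h) <= sqn (t *: g + h) + t * sqn (g - h).
Proof.
move=> t0 gb hb; rewrite -[sqn (_ - _)]mul1r; apply: sqn_le2 => // e1 e2.
rewrite mul1r; have [u [v <-]] := legendre_scale g h e1 e2 t0.
have tgb := sqboundedZ t gb.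
rewrite lerD// ?ler_pM2l// legendre_le_sqn//.
- exact: sqboundedD.
- exact: sqboundedB.
Qed.

Lemma sqn_scale (t : R) g h : 0 < t -> sqbounded g -> sqbounded h ->
  sqn (t *: g + h) - sqn (t *: g - h) = t * (sqn (g + h) - sqn (g - h)).
Proof.
move=> t0 gb hb; have := sqn_scale_le t0 gb hb.
(* Replacing [h] by [- h] reverses the inequality. *)
have hNb : sqbounded (- h) by rewrite -scaleN1r; exact: sqboundedZ.
by have := sqn_scale_le t0 gb hNb; rewrite opprK; lra.
Qed.

(* Cauchy-Schwarz: test [legendre] on the multiples of the point [x]. *)
Lemma sqn_eval g x : sqbounded g -> g x ^+ 2 <= sqn g * K x x.
Proof.
move=> gb; have le t := legendre_le_sqn [:: (t, x)] gb.
rewrite /legendre /cross /lincomb in le.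
have {}le t : 2 * t * g x - t ^+ 2 * K x x <= sqn g.
  apply: le_trans (le t); rewrite !big_seq1/=; lra.
have : 0 <= K x x.
  have := @kernel_ge0 _ _ K [:: (1, x)].
  by rewrite /cross /lincomb !big_seq1/= !mul1r.
rewrite le_eqVlt => /orP[/eqP K0|K0].
  (* If [K x x = 0], the bound is linear in [t], and a nonzero [g x] would let its left side reach
     [sqn g + 1]. *)
  rewrite -K0 mulr0; have [->|gx0] := eqVneq (g x) 0; first by rewrite expr0n.
  have := le ((sqn g + 1) / (2 * g x)).
  rewrite -K0 mulr0 subr0 (_ : _ * _ * _ = sqn g + 1); first by lra.
  by field.
(* The quadratic in [t] is maximal at [t = g x / K x x]. *)
rewrite -ler_pdivrMr//; apply: le_trans (le (g x / K x x)).
by rewrite le_eqVlt; apply/orP; left; apply/eqP; field; rewrite gt_eqF.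
Qed.

Lemma sqn_eq0 g : sqbounded g -> sqn g = 0 -> g = 0.
Proof.
move=> gb g0; apply/funext => x; have := sqn_eval x gb.
by rewrite g0 mul0r => gx; apply/eqP; rewrite -sqrf_eq0 eq_le gx sqr_ge0.
Qed.

(** Completing the square turns [legendre g e] into [|d|^2 - |d - e|^2], which is maximal at
    [e = d]. *)
Lemma sqn_dual g d : (forall e, lincomb g e = cross K d e) ->
  sqbounded g /\ sqn g = cross K d d.
Proof.
move=> gd; have legE e :
    legendre g e = cross K d d - cross K (comb 1 d (-1) e) (comb 1 d (-1) e).
  rewrite cross_combl !cross_combr (crossC (@kernelC _ _ K) e d) /legendre gd.
  by ring.
have leg_le e : legendre g e <= cross K d d.
  by rewrite legE lerBlDr lerDl kernel_ge0.
split; first by exists (cross K d d).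
apply/eqP; rewrite eq_le sqn_le//=.
have /(legendre_le_sqn d) : sqbounded g by exists (cross K d d).
by apply: le_trans; rewrite /legendre gd le_eqVlt; apply/orP; left; apply/eqP; ring.
Qed.

End Legendre.

(** * The Hilbert space of a positive semidefinite kernel *)

Section KernelSpace.
Context {R : realType} {X : Type} (K : psdKernel R X).

Definition sqbounded_pred : {pred X -> R} := [pred g | `[< sqbounded K g >]].

Lemma sqbounded_submod_closed : submod_closed sqbounded_pred.
Proof.
split; first by apply/asboolP; exact: (sqbounded0 K).
move=> a g h /asboolP gb /asboolP hb; apply/asboolP.
by apply: sqboundedD => //; exact: sqboundedZ.
Qed.

HB.instance Definition _ :=
  GRing.isSubmodClosed.Build R (X -> R) sqbounded_pred sqbounded_submod_closed.

Record kernel_space := KernelSpace {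
  kernel_space_fun :> X -> R ;
  kernel_space_subproof : kernel_space_fun \in sqbounded_pred }.

HB.instance Definition _ := [isSub for kernel_space_fun].
HB.instance Definition _ := [Choice of kernel_space by <:].
HB.instance Definition _ := [SubChoice_isSubLmodule of kernel_space by <:].

Implicit Types g h k : kernel_space.

Lemma kernel_spaceP g : sqbounded K g.
Proof. by apply/asboolP; exact: (valP g). Qed.
#[local] Hint Resolve kernel_spaceP : core.

Definition kernel_dot g h : R :=
  (sqn K (val g + val h) - sqn K (val g - val h)) / 4.

Lemma kernel_dotgg g : kernel_dot g g = sqn K g.
Proof.
rewrite /kernel_dot subrr sqn0 subr0 sqn_double//=.
by rewrite mulrAC divff ?mul1r.
Qed.

Lemma kernel_dotC g h : kernel_dot g h = kernel_dot h g.
Proof.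
rewrite /kernel_dot [val g + _]addrC; congr ((_ - _) / _).
have := sqn_parallelogram (sqbounded0 K)
  (sqboundedB (kernel_spaceP g) (kernel_spaceP h)).
by rewrite sqn0 add0r sub0r opprB/=; lra.
Qed.

(** Jordan-von Neumann argument: subtracting the parallelogram laws for [u + k, v] and [u - k, v]
    gives [half]. Its instances at [(g, h)] and [(h, g)] add up to additivity, since the form is odd
    in its first argument. *)
Lemma kernel_dotDl g h k :
  kernel_dot (g + h) k = kernel_dot g k + kernel_dot h k.
Proof.
have half (u v : kernel_space) :
    kernel_dot (u + v) k + kernel_dot (u - v) k = 2 * kernel_dot u k.
  have [[ub vb] kb] := (kernel_spaceP u, kernel_spaceP v, kernel_spaceP k).
  have := sqn_parallelogram (sqboundedD ub kb) vb.
  have := sqn_parallelogram (sqboundedB ub kb) vb.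
  rewrite /kernel_dot/=.
  rewrite ![_ + _ + val v]addrAC ![_ + _ - val v]addrAC.
  lra.
have := half g h; have := half h g; rewrite [h + g]addrC.
have dotN (u : kernel_space) : kernel_dot (- u) k = - kernel_dot u k.
  by rewrite kernel_dotC [kernel_dot u k]kernel_dotC /kernel_dot /= opprK; lra.
by rewrite -[h - g]opprB dotN; lra.
Qed.

Lemma kernel_dotZl a g h : kernel_dot (a *: g) h = a * kernel_dot g h.
Proof.
have pos b u : 0 < b -> kernel_dot (b *: u) h = b * kernel_dot u h.
  move=> b0; rewrite /kernel_dot linearZ/= sqn_scale//=.
  by rewrite mulrA.
have dot0 : kernel_dot 0 h = 0.
  by have := kernel_dotDl 0 0 h; rewrite addr0; lra.
have [a0|a0|->] := ltgtP a 0; last by rewrite scale0r mul0r.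
  have := kernel_dotDl (a *: g) ((- a) *: g) h.
  rewrite -scalerDl subrr scale0r dot0 (pos (- a)) ?oppr_gt0// mulNr; lra.
exact: pos.
Qed.


Lemma kernel_dot_bilinear :
  bilinear_for *%R (idfun \; *%R)
    (kernel_dot : kernel_space -> kernel_space -> R).
Proof.
split=> [h a g k|g a h k] /=; first by rewrite kernel_dotDl kernel_dotZl.
by rewrite ![kernel_dot g _]kernel_dotC kernel_dotDl kernel_dotZl.
Qed.

HB.instance Definition _ :=
  bilinear_isBilinear.Build R kernel_space kernel_space R
  *%R (idfun \; *%R) kernel_dot kernel_dot_bilinear.

Lemma kernel_dot_herm g h :
  kernel_dot g h = (-1) ^+ false * idfun (kernel_dot h g).
Proof. by rewrite expr0 mul1r kernel_dotC. Qed.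

HB.instance Definition _ := isHermitianSesquilinear.Build R kernel_space
  false idfun kernel_dot kernel_dot_herm.

Lemma kernel_dot_eq0 g : kernel_dot g g = 0 -> g = 0.
Proof. by rewrite kernel_dotgg => /sqn_eq0 g0; apply: val_inj; exact: g0. Qed.

Lemma kernel_dot_gt0 g : g != 0 -> 0 < kernel_dot g g.
Proof.
apply: contra_neqT; rewrite -leNgt => g0; apply: kernel_dot_eq0.
by apply/eqP; rewrite eq_le g0 kernel_dotgg sqn_ge0.
Qed.

HB.instance Definition _ := isDotProduct.Build R kernel_space
  kernel_dot kernel_dot_gt0.

Lemma kernel_dot_cauchy_schwarz g h :
  kernel_dot g h ^+ 2 <= kernel_dot g g * kernel_dot h h.
Proof.
have [->|h0] := eqVneq h 0.
  by rewrite !linear0r expr0n.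
have hh0 := kernel_dot_gt0 h0.
pose u := kernel_dot h h *: g - kernel_dot g h *: h.
have uu : kernel_dot u u =
    kernel_dot h h * (kernel_dot g g * kernel_dot h h - kernel_dot g h ^+ 2).
  have lin k : kernel_dot u k =
      kernel_dot h h * kernel_dot g k - kernel_dot g h * kernel_dot h k.
    by rewrite /u -scaleNr kernel_dotDl !kernel_dotZl mulNr.
  rewrite lin [kernel_dot g u]kernel_dotC [kernel_dot h u]kernel_dotC !lin.
  by rewrite (kernel_dotC h g); ring.
by rewrite -subr_ge0 -(pmulr_rge0 _ hh0) -uu kernel_dotgg sqn_ge0.
Qed.

Definition kernel_norm g : R := Num.sqrt (kernel_dot g g).

Lemma kernel_normD g h : kernel_norm (g + h) <= kernel_norm g + kernel_norm h.
Proof.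
have ge0 k : 0 <= kernel_dot k k by rewrite kernel_dotgg sqn_ge0.
rewrite -(@ler_pXn2r _ 2) ?nnegrE ?addr_ge0 ?sqrtr_ge0// sqrrD !sqr_sqrtr//.
rewrite kernel_dotDl ![kernel_dot _ (g + h)]kernel_dotC !kernel_dotDl.
rewrite [kernel_dot h g]kernel_dotC.
have : kernel_dot g h <= kernel_norm g * kernel_norm h.
  rewrite -sqrtrM// (le_trans (ler_norm _))// -sqrtr_sqr ler_wsqrtr//.
  exact: kernel_dot_cauchy_schwarz.
rewrite mulr2n; lra.
Qed.

Lemma kernel_normZ a g : kernel_norm (a *: g) = `|a| * kernel_norm g.
Proof.
rewrite /kernel_norm kernel_dotZl kernel_dotC kernel_dotZl mulrA -expr2.
by rewrite sqrtrM ?sqr_ge0// sqrtr_sqr.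
Qed.

Lemma kernel_norm0_eq0 g : kernel_norm g = 0 -> g = 0.
Proof.
move=> /eqP; rewrite sqrtr_eq0 => g0; apply: kernel_dot_eq0.
by apply/eqP; rewrite eq_le g0 kernel_dotgg sqn_ge0.
Qed.

HB.instance Definition _ := Lmodule_isNormed.Build R kernel_space
  kernel_normD kernel_normZ kernel_norm0_eq0.

Lemma kernel_dotE g : kernel_dot g g = `|g| ^+ 2.
Proof. by rewrite sqr_sqrtr// kernel_dotgg sqn_ge0. Qed.

(** Continuity of the point evaluations, by which Cauchy filters converge pointwise. *)
Lemma kernel_eval_le g x : `|g x| <= `|g| * Num.sqrt (K x x).
Proof.
have sq0 : 0 <= sqn K g := sqn_ge0 (kernel_spaceP g).
rewrite -sqrtr_sqr -sqrtrM ?kernel_dotgg// ler_wsqrtr//.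
exact: sqn_eval (kernel_spaceP g).
Qed.

(** * Completeness of the kernel space *)

Section Completeness.
Context (F : set_system kernel_space) {FF : ProperFilter F}.
Context (Fcauchy : cauchy F).

Let near_dist (eps : R) : 0 < eps ->
  exists2 g, F (ball g eps) & \forall h \near F, `|g - h| < eps.
Proof.
move=> eps0; have /cauchyP/(_ _ eps0)[g Fg] := Fcauchy.
by exists g => //; near do rewrite -ball_normE.
Unshelve. all: by end_near. Qed.

Let pointwise_lim (x : X) : R := lim (g x @[g --> F]).

Let pointwise_cvg x : g x @[g --> F] --> pointwise_lim x.
Proof.
apply: R_complete; apply: cauchy_exP => eps eps0.
have s0 : 0 < Num.sqrt (K x x) + 1 by rewrite ltr_wpDl ?sqrtr_ge0.
have [g _ gF] := near_dist (divr_gt0 eps0 s0).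
exists (g x); apply: filterS gF => h gh.
rewrite /= -ball_normE /=; apply: (le_lt_trans (kernel_eval_le (g - h) x)).
rewrite (@le_lt_trans _ _ (`|g - h| * (Num.sqrt (K x x) + 1)))//.
  by rewrite ler_wpM2l// lerDl.
by rewrite -ltr_pdivlMr.
Qed.

Let lincomb_cvg e : lincomb g e @[g --> F] --> lincomb pointwise_lim e.
Proof.
rewrite /lincomb; apply: cvg_big => [|p _]; first exact: add_continuous.
by apply: cvgMr; exact: pointwise_cvg.
Qed.

(** Lower semicontinuity of [sqn] under pointwise convergence: for fixed [e] the term
    [legendre K (g - h) e] depends continuously on finitely many values of [h], so the bound
    [eps ^+ 2] valid for [h] near [F] survives in the limit. *)
Let near_legendre (eps : R) : 0 < eps ->
  \forall g \near F, forall e, legendre K (val g - pointwise_lim) e <= eps ^+ 2.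
Proof.
move=> eps0; have [g0 _ g0F] := near_dist (divr_gt0 eps0 (ltr0n R 2)).
apply: filterS (g0F) => g gg0 e.
have lim : legendre K (val g - val h) e @[h --> F] -->
    legendre K (val g - pointwise_lim) e.
  rewrite /legendre lincombB; apply: cvgB; last exact: cvg_cst.
  have -> : (fun h : kernel_space => 2 * lincomb (val g - val h) e) =
            (fun h : kernel_space => 2 * (lincomb g e - lincomb h e)).
    by apply/funext => h; rewrite lincombB.
  by apply: cvgMr; apply: cvgB; [exact: cvg_cst|exact: lincomb_cvg].
apply: (cvgr_to_le lim); apply: filterS g0F => h hg0.
rewrite (le_trans (legendre_le_sqn e (kernel_spaceP (g - h))))//.
rewrite -kernel_dotgg kernel_dotE ler_pXn2r ?nnegrE ?(ltW eps0)//.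
rewrite (le_trans (ler_distD g0 _ _))// [`|g - g0|]distrC [eps]splitr.
by rewrite lerD// ltW.
Qed.

Lemma kernel_space_cvg : cvg F.
Proof.
have [g /(_ _) gF] : exists g : kernel_space,
    forall e, legendre K (val g - pointwise_lim) e <= 1 ^+ 2.
  exact: filter_ex (near_legendre ltr01).
(* The limit is [g - (g - pointwise_lim)], a difference of two bounded functionals. *)
have lb : sqbounded K pointwise_lim.
  rewrite -[pointwise_lim](subKr (val g)).
  by apply: sqboundedB => //; exists (1 ^+ 2).
have l_in : pointwise_lim \in sqbounded_pred by apply/asboolP.
apply/cvg_ex; exists (KernelSpace l_in); apply/cvgrPdist_le => eps eps0.
apply: filterS (near_legendre eps0) => h hl.
rewrite distrC -(@ler_pXn2r _ 2) ?nnegrE ?(ltW eps0)//.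
by rewrite -kernel_dotE kernel_dotgg; exact: sqn_le.
Qed.

End Completeness.

HB.instance Definition _ := Uniform_isComplete.Build kernel_space
  kernel_space_cvg.

Definition kernel_hilbert : real_hilbertType R :=
  @HilbertType R idfun kernel_space kernel_dot kernel_dotE.

(** Reproducing property: the section [K x] is represented by the point mass at [x], so [sqn_dual]
    applies. The difference of two sections is treated in the same way below. *)
Lemma sqn_kernel x : sqbounded K (K x) /\ sqn K (K x) = K x x.
Proof.
have cross1 e : lincomb (K x) e = cross K [:: (1, x)] e.
  by rewrite /cross [RHS]/lincomb big_seq1/= mul1r.
have [? ->] := sqn_dual cross1; split => //.
by rewrite -cross1 /lincomb big_seq1 mul1r.
Qed.

Lemma kernel_section_in x : K x \in sqbounded_pred.
Proof. by apply/asboolP; have [] := sqn_kernel x. Qed.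

Definition kernel_section x : kernel_hilbert :=
  KernelSpace (kernel_section_in x).

Lemma kernel_section_dist x y :
  `|kernel_section x - kernel_section y| ^+ 2 = K x x + K y y - 2 * K x y.
Proof.
rewrite -dotvE/= kernel_dotgg/=.
have cross2 e : lincomb (K x - K y) e = cross K [:: (1, x); (-1, y)] e.
  rewrite /cross lincombB [RHS]/lincomb big_cons big_seq1/= mul1r.
  by rewrite mulN1r.
have [_ ->] := sqn_dual cross2.
rewrite -cross2 /lincomb big_cons big_seq1/= (_ : (K x - K y) x = K x x - K y x)//.
rewrite (_ : (K x - K y) y = K x y - K y y)// (kernelC K y x).
by ring.
Qed.

End KernelSpace.

(** * The kernel |<x, y>|^2 / (|x| |y|) and the embedding of V/G *)

Section DotTheory.
Context {K : numFieldType} {theta : K -> K} {V : hilbertType theta}.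
Implicit Types (x y z : V) (a : K).

Lemma dotvDl x y z : dotv V (x + y) z = dotv V x z + dotv V y z.
Proof. exact: linearDl. Qed.

Lemma dotvDr x y z : dotv V z (x + y) = dotv V z x + dotv V z y.
Proof. exact: linearDr. Qed.

Lemma dotvZl a x y : dotv V (a *: x) y = a * dotv V x y.
Proof. exact: linearZl_LR. Qed.

Lemma dotvZr a x y : dotv V x (a *: y) = theta a * dotv V x y.
Proof. exact: linearZr_LR. Qed.

Lemma dotvNl x y : dotv V (- x) y = - dotv V x y.
Proof. exact: linearNl. Qed.

Lemma dotvNr x y : dotv V x (- y) = - dotv V x y.
Proof. exact: linearNr. Qed.

Lemma dotv0l y : dotv V 0 y = 0.
Proof. exact: linear0l. Qed.

Lemma dotvC x y : dotv V y x = theta (dotv V x y).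
Proof. by rewrite hermitian_subproof expr0 mul1r. Qed.

End DotTheory.

(** * Positivity of the kernel |<x, y>|^2 *)

Section HilbertForm.
Context {C : numClosedFieldType} {V : hilbertType (@Num.conj C)}.
Implicit Types (x y z u : V) (a : C) (e : seq (C * V)).

(** For real weights [c_p] this is the squared Hilbert-Schmidt norm of the operator [A], the sum of
    the [c_p] times the rank-one operators of [x_p]. The squared modulus is written as a product of
    two inner products to stay polynomial. *)
Definition sqdot_sum e : C := \sum_(p <- e) \sum_(q <- e)
  p.1 * q.1 * (dotv V p.2 q.2 * dotv V q.2 p.2).

Definition ortho_part u x : V := x - dotv V x u *: u.

Lemma dotv_split u x y : `|u| = 1 ->
  dotv V x y = dotv V x u * (dotv V y u)^* +
               dotv V (ortho_part u x) (ortho_part u y).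
Proof.
move=> u1; have uu : dotv V u u = 1 by rewrite dotvE u1 expr1n.
rewrite /ortho_part dotvDl !dotvDr !dotvNl !dotvNr !dotvZl !dotvZr uu.
by rewrite -(dotvC y u); ring.
Qed.

(** Block decomposition of [A] along [u] and its orthogonal complement: [s] is the diagonal entry at
    [u], [W] the off-diagonal column, and the squared norm of [A] is [s^2 + 2 |W|^2] plus that of
    the remaining block. Real weights make [s] real. *)
Lemma sqdot_sum_ortho u e : `|u| = 1 -> all (fun p => p.1 \is Num.real) e ->
  sqdot_sum [seq (p.1, ortho_part u p.2) | p <- e] <= sqdot_sum e.
Proof.
move=> u1 /allP ereal.
pose W := \sum_(p <- e) (p.1 * (dotv V p.2 u)^*) *: ortho_part u p.2.
pose s := \sum_(p <- e) p.1 * (dotv V p.2 u * (dotv V p.2 u)^*).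
have sE : \sum_(p <- e) \sum_(q <- e) p.1 * q.1 *
    (dotv V p.2 u * (dotv V p.2 u)^* * (dotv V q.2 u * (dotv V q.2 u)^*)) = s ^+ 2.
  rewrite expr2 big_distrl; apply: eq_bigr => p _ /=.
  by rewrite big_distrr; apply: eq_bigr => q _ /=; ring.
have WE : \sum_(p <- e) \sum_(q <- e) p.1 * q.1 *
    ((dotv V p.2 u)^* * dotv V q.2 u *
     dotv V (ortho_part u p.2) (ortho_part u q.2)) = dotv V W W.
  rewrite {1}/W linear_sumlz; apply: eq_bigr => p _ /=.
  rewrite /W linear_sumr [RHS]big_seq [LHS]big_seq; apply: eq_bigr => q qe /=.
  rewrite dotvZl dotvZr rmorphM /= conjCK (CrealP (ereal _ qe)); ring.
have WE' : \sum_(p <- e) \sum_(q <- e) p.1 * q.1 *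
    (dotv V p.2 u * (dotv V q.2 u)^* *
     dotv V (ortho_part u q.2) (ortho_part u p.2)) = dotv V W W.
  rewrite exchange_big -WE; apply: eq_bigr => p _ /=.
  by apply: eq_bigr => q _ /=; ring.
have -> : sqdot_sum e = s ^+ 2 + dotv V W W + dotv V W W +
    sqdot_sum [seq (p.1, ortho_part u p.2) | p <- e].
  rewrite -sE -{1}WE' -WE /sqdot_sum big_map -!big_split; apply: eq_bigr => p _ /=.
  rewrite big_map -!big_split; apply: eq_bigr => q _ /=.
  by rewrite (dotv_split p.2 q.2 u1) (dotv_split q.2 p.2 u1); ring.
rewrite lerDr !addr_ge0 ?dnorm_ge0// real_exprn_even_ge0//.
rewrite /s big_seq; apply: rpred_sum => p pe.
by rewrite rpredM ?ereal// -normCK rpredX// normr_real.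
Qed.

(* Projecting away from the first vector kills it and decreases [sqdot_sum]. *)
Lemma sqdot_sum_ge0 e : all (fun p => p.1 \is Num.real) e -> 0 <= sqdot_sum e.
Proof.
have [n] := ubnP (size e); elim: n e => // n IHn [|[c x] e] /= en.
  by rewrite /sqdot_sum big_nil.
move=> /[dup] cereal /andP[creal ereal].
have drop0 e' : sqdot_sum ((c, 0) :: e') = sqdot_sum e'.
  rewrite /sqdot_sum big_cons big1 ?add0r => [|q _]; last first.
    by rewrite dotv0l mul0r mulr0.
  by apply: eq_bigr => p _; rewrite big_cons/= dotv0l mulr0 mulr0 add0r.
have [->|x0] := eqVneq x 0; first by rewrite drop0 IHn.
have nx0 : `|x| != 0 by rewrite normr_eq0.
pose u := (Num.norm x)^-1 *: x.
have u1 : `|u| = 1.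
  by rewrite normrZ normfV normr_id mulVf.
have := @sqdot_sum_ortho u ((c, x) :: e) u1.
rewrite /= cereal => /(_ isT); apply: le_trans.
have -> : ortho_part u x = 0.
  rewrite /ortho_part /u dotvZr scalerA dotvE fmorphV /=.
  rewrite (CrealP (normr_real x)) expr2 mulrA mulVf// mul1r divff// scale1r.
  by rewrite subrr.
rewrite drop0; apply: IHn; first by rewrite size_map.
by rewrite all_map.
Qed.

End HilbertForm.

(** * The embedding of the quotient and its Lipschitz bounds *)

Section FubiniStudyKernel.
Context {R : realType} (V : complex_hilbertType R).
Implicit Types (x y : V).

Definition rnorm x : R := complex.Re `|x|.

Definition absdot x y : R := complex.Re `|dotv V x y|.

Lemma rnormE x : (rnorm x)%:C%C = `|x|.
Proof. exact: Re_normv. Qed.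

Lemma absdotE x y : (absdot x y)%:C%C = `|dotv V x y|.
Proof. by rewrite RRe_real// normr_real. Qed.

Lemma rnorm_ge0 x : 0 <= rnorm x.
Proof. by rewrite -lecR rnormE; exact: normr_ge0. Qed.

Lemma absdot_ge0 x y : 0 <= absdot x y.
Proof. by rewrite -lecR absdotE; exact: normr_ge0. Qed.

Lemma absdotC x y : absdot x y = absdot y x.
Proof. by apply: complexI; rewrite !absdotE dotvC norm_conjC. Qed.

Lemma absdotxx x : absdot x x = rnorm x ^+ 2.
Proof.
apply: complexI; rewrite absdotE rmorphXn/= rnormE dotvE.
by rewrite normrX normr_id.
Qed.

Lemma sqr_rotation_norm (w : R[i]) x y : `|w| = 1 ->
  `|w *: x - y| ^+ 2 =
  `|x| ^+ 2 + `|y| ^+ 2 - (w * dotv V x y + (w * dotv V x y)^*).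
Proof.
move=> w1; rewrite -!dotvE dnormB dnormZ w1 expr1n mul1r.
by rewrite dotvZl.
Qed.

(** Expanding the square leaves [- 2 Re (w <x, y>)], which is smallest when [w] turns [<x, y>] into
    its modulus. *)
Lemma rotation_dist_sqr x y :
  rotation_dist x y ^+ 2 = rnorm x ^+ 2 + rnorm y ^+ 2 - 2 * absdot x y.
Proof.
set c := dotv V x y.
have rhsE : (rnorm x ^+ 2 + rnorm y ^+ 2 - 2 * absdot x y)%:C%C =
    `|x| ^+ 2 + `|y| ^+ 2 - 2 * `|c|.
  by rewrite rmorphB rmorphD !rmorphXn/= !rnormE rmorphM/= absdotE rmorph_nat.
apply/eqP; rewrite eq_le; apply/andP; split.
  have [w w1 wc] : exists2 w : R[i], `|w| = 1 & w * c = `|c|.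
    have [->|c0] := eqVneq c 0; first by exists 1; rewrite ?normr1// mul1r normr0.
    exists (`|c| / c); last by rewrite divfK.
    by rewrite normf_div normr_id divff// normr_eq0.
  have := rotation_dist_le x y w1.
  rewrite -(@ler_pXn2r _ 2) ?nnegrE ?rotation_dist_ge0//; last first.
    by rewrite -lecR Re_normv; exact: normr_ge0.
  move/le_trans; apply; rewrite -lecR rhsE rmorphXn/= Re_normv.
  rewrite sqr_rotation_norm// -/c wc (CrealP (normr_real _)).
  by rewrite mulrDl mul1r.
have [w w1 ->] := rotation_dist_attained x y.
rewrite -lecR rhsE rmorphXn/= Re_normv sqr_rotation_norm// lerD2l lerN2 -/c.
have -> : w * c + (w * c)^* = 2 * 'Re (w * c).
  by rewrite ReE [2 * _]mulrC divfK// pnatr_eq0.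
rewrite ler_pM2l ?ltr0n// (le_trans (real_ler_norm (Creal_Re _)))//.
by rewrite (le_trans (leif_normC_Re_Creal _).1)// normrM w1 mul1r.
Qed.

(** The normalisation gives [fs_kernel x x = |x|^2]. At a zero vector, division by zero yields 0,
    which is the intended value. *)
Definition fs_kernel x y : R := absdot x y ^+ 2 / (rnorm x * rnorm y).

Lemma fs_kernelC x y : fs_kernel x y = fs_kernel y x.
Proof. by rewrite /fs_kernel absdotC [rnorm x * _]mulrC. Qed.

Lemma fs_kernel_psd e : 0 <= cross fs_kernel e e.
Proof.
rewrite -lecR.
(* The factors [1 / |x|] are absorbed into the weights. *)
pose e' : seq (R[i] * V) := [seq ((p.1 / rnorm p.2)%:C%C, p.2) | p <- e].
have -> : (cross fs_kernel e e)%:C%C = sqdot_sum e'.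
  rewrite /sqdot_sum big_map /cross /lincomb rmorph_sum; apply: eq_bigr => p _ /=.
  rewrite big_map big_distrr rmorph_sum; apply: eq_bigr => q _ /=.
  rewrite [dotv V q.2 p.2]dotvC -normCK -absdotE -!(rmorphM, rmorphXn) /=.
  by congr (_%:C)%C; rewrite /fs_kernel invfM; ring.
by apply: sqdot_sum_ge0; rewrite all_map; apply/allP => p _ /=; rewrite complex_real.
Qed.

Definition fs_psd_kernel : psdKernel R V := PsdKernel fs_kernelC fs_kernel_psd.

Lemma fs_kernelxx x : fs_kernel x x = rnorm x ^+ 2.
Proof.
rewrite /fs_kernel absdotxx; have [->|x0] := eqVneq (rnorm x) 0.
  by rewrite mul0r invr0 mulr0 expr0n.
by field.
Qed.

(** Cauchy-Schwarz in [V], read off from the kernel space: [sqn_eval] for the section at [y] gives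
    [fs_kernel y x <= |x| |y|]. Vanishing norms are separate, as the quotient then loses
    [absdot x y]. *)
Lemma absdot_le x y : absdot x y <= rnorm x * rnorm y.
Proof.
have [xy0|xy0] := eqVneq (rnorm x * rnorm y) 0.
  suff -> : absdot x y = 0 by rewrite xy0.
  apply: complexI; rewrite absdotE.
  have /orP[/eqP n0|/eqP n0] : (rnorm x == 0) || (rnorm y == 0).
    by rewrite -mulf_eq0 xy0.
  - have /eqP : `|x| = 0 by rewrite -rnormE n0.
    by rewrite normr_eq0 => /eqP ->; rewrite dotv0l normr0.
  - have /eqP : `|y| = 0 by rewrite -rnormE n0.
    by rewrite normr_eq0 => /eqP ->; rewrite dotvC dotv0l rmorph0 normr0.
have xy_gt0 : 0 < rnorm x * rnorm y by rewrite lt_def xy0 mulr_ge0 ?rnorm_ge0.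
have [yb yE] := sqn_kernel fs_psd_kernel y.
have := sqn_eval x yb; rewrite yE/= !fs_kernelxx -exprMn.
rewrite -[fs_kernel y x]fs_kernelC ler_pXn2r ?nnegrE//; last 2 first.
- by rewrite divr_ge0 ?sqr_ge0// ltW.
- by rewrite mulrC ltW.
rewrite /fs_kernel ler_pdivrMr// [rnorm y * _]mulrC -expr2 ler_pXn2r ?nnegrE//.
- exact: absdot_ge0.
- exact: ltW.
Qed.

Definition fs_embedding (X : circle_quotient V) :
    kernel_hilbert fs_psd_kernel :=
  kernel_section fs_psd_kernel (circle_repr X).

Lemma fs_embedding_bounds (X Y : circle_quotient V) :
  mdist X Y <= `|fs_embedding X - fs_embedding Y| /\
  `|fs_embedding X - fs_embedding Y| <= Num.sqrt 2 * mdist X Y.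
Proof.
set x := circle_repr X; set y := circle_repr Y.
have -> : mdist X Y = rotation_dist x y by [].
have d0 := rotation_dist_ge0 x y.
have fE : `|fs_embedding X - fs_embedding Y| ^+ 2 =
    rnorm x ^+ 2 + rnorm y ^+ 2 - 2 * fs_kernel x y.
  by rewrite -!fs_kernelxx; exact: kernel_section_dist.
have dE := rotation_dist_sqr x y.
have s_le := absdot_le x y; have s_ge0 := absdot_ge0 x y.
have [a0 b0] := (rnorm_ge0 x, rnorm_ge0 y).
rewrite -(@ler_pXn2r _ 2 isT) ?nnegrE//.
rewrite -(@ler_pXn2r _ 2 isT _ (Num.sqrt 2 * _)) ?nnegrE ?mulr_ge0 ?sqrtr_ge0//.
rewrite exprMn fE [Num.sqrt 2 ^+ 2]sqr_sqrtr// dE /fs_kernel.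
move: s_le s_ge0 a0 b0; set s := absdot x y; set a := rnorm x; set b := rnorm y.
move=> s_le s_ge0 a0 b0.
have sqr := sqr_ge0 (a - b); rewrite sqrrB mulr2n in sqr.
have [ab0|ab0] := eqVneq (a * b) 0.
  (* Here both squared distances equal [a^2 + b^2]. *)
  rewrite ab0 invr0 mulr0; have s0 : s = 0 by lra.
  by rewrite s0; split; lra.
have abp : 0 < a * b by rewrite lt_def ab0 mulr_ge0.
(* Lower bound: the squared distances differ by [2 (s - s^2 / (a b))]. *)
have q_le : s ^+ 2 / (a * b) <= s by rewrite ler_pdivrMr// expr2 ler_wpM2l.
(* Upper bound: [2 d^2 - |f x - f y|^2 = (a - b)^2 + 2 (a b - s)^2 / (a b)]. *)
have : 0 <= (a * b - s) ^+ 2 / (a * b) by rewrite divr_ge0 ?sqr_ge0// ltW.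
have -> : (a * b - s) ^+ 2 / (a * b) = a * b - 2 * s + s ^+ 2 / (a * b).
  move: ab0; rewrite mulf_eq0 negb_or => /andP[an0 bn0].
  by field; apply/andP; split.
by split; lra.
Qed.

End FubiniStudyKernel.

(** * The Poincare inequality on a cycle *)

Section CyclicSums.
Context {R : realType} (H : real_hilbertType R).
Implicit Types (n m j k : nat).

Lemma periodic_sum n j (phi : nat -> R) : (forall k, phi (k + n)%N = phi k) ->
  \sum_(0 <= k < n) phi (k + j)%N = \sum_(0 <= k < n) phi k.
Proof.
move=> phin; elim: j => [|j IHj]; first by under eq_bigr do rewrite addn0.
rewrite -IHj; apply/eqP; rewrite -subr_eq0 -sumrB.
under eq_bigr do rewrite addnS -addSn.
by rewrite (telescope_sumr (fun k => phi (k + j)%N))// addnC phin add0n subrr.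
Qed.

Lemma norm2_addB2 (a b c : H) (t : R) :
  `|a + b - (2 * t) *: c| ^+ 2 = `|a| ^+ 2 + `|b| ^+ 2 + 4 * t ^+ 2 * `|c| ^+ 2 +
    2 * dotv H a b - 4 * t * dotv H a c - 4 * t * dotv H c b.
Proof.
rewrite -!dotvE !dotvDl !dotvDr !dotvNl !dotvNr !dotvZl !dotvZr/=.
by rewrite (dotvC a b) (dotvC a c) (dotvC c b)/=; ring.
Qed.

Definition autocorr n (g : nat -> H) j : R :=
  \sum_(0 <= k < n) dotv H (g (k + j)%N) (g k).

(** Sum over a period of [|g (k + 2 j) + g k - 2 t g (k + j)|^2 >= 0]. These vectors vanish for a
    uniform rotation whose step [j] turns by an angle of cosine [t], which dictates the later choice
    of [t]. *)
Lemma autocorr_double n (g : nat -> H) j (t : R) :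
  (forall k, g (k + n)%N = g k) ->
  4 * t * autocorr n g j <= (1 + 2 * t ^+ 2) * autocorr n g 0 + autocorr n g (j + j).
Proof.
move=> gn.
have gnj k i : g (k + n + i)%N = g (k + i)%N by rewrite addnAC gn.
have norm_shift i : \sum_(0 <= k < n) `|g (k + i)%N| ^+ 2 = autocorr n g 0.
  rewrite (@periodic_sum _ _ (fun k => `|g k| ^+ 2)) => [|k]; last by rewrite gn.
  by apply: eq_bigr => k _; rewrite addn0 dotvE.
have corr_shift i : \sum_(0 <= k < n) dotv H (g (k + i + j)%N) (g (k + i)%N) =
    autocorr n g j.
  rewrite (@periodic_sum _ _ (fun k => dotv H (g (k + j)%N) (g k)))// => k.
  by rewrite gnj gn.
have : 0 <= \sum_(0 <= k < n)
    `|g (k + j + j)%N + g k - (2 * t) *: g (k + j)%N| ^+ 2.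
  by apply: sumr_ge0 => k _; exact: sqr_ge0.
under eq_bigr do rewrite norm2_addB2.
rewrite !sumrB !big_split/= -!big_distrr/= norm_shift corr_shift.
have -> : \sum_(0 <= k < n) `|g (k + j + j)%N| ^+ 2 = autocorr n g 0.
  by under eq_bigr do rewrite -addnA; exact: norm_shift.
have -> : \sum_(0 <= k < n) `|g k| ^+ 2 = autocorr n g 0.
  by rewrite -(norm_shift 0%N); apply: eq_bigr => k _; rewrite addn0.
have -> : \sum_(0 <= k < n) dotv H (g (k + j + j)%N) (g k) = autocorr n g (j + j).
  by apply: eq_bigr => k _; rewrite addnA.
rewrite -/(autocorr n g j); lra.
Qed.

Lemma cos_pi_exp2_gt0 i : 0 < cos (pi / 2 ^+ i.+2 : R).
Proof.
apply: cos_gt0_pihalf; rewrite (@lt_trans _ _ 0) ?oppr_lt0 ?divr_gt0 ?pi_gt0//=.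
rewrite ltr_pM2l ?pi_gt0// ltf_pV2 ?posrE ?exprn_gt0//.
by rewrite exprS ltr_pMr ?exprn_egt1 ?ltr1n.
Qed.

Lemma cos_pi_exp2_double i :
  cos (pi / 2 ^+ i : R) = 2 * cos (pi / 2 ^+ i.+1 : R) ^+ 2 - 1.
Proof.
rewrite mulr_natl -cos_mulr2n; congr cos.
by rewrite exprS invfM -mulr_natr; field; rewrite expf_neq0.
Qed.

(* The autocorrelation at the quarter period [2 ^ p] vanishes, since a shift by
   half a period flips signs; [autocorr_double], with [t] a cosine, then descends
   through the half-angle formula. *)
Lemma autocorr_alternating p (g : nat -> H) :
  (forall k, g (k + 2 ^ p.+1)%N = - g k) ->
  autocorr (2 ^ p.+2) g 1 <= cos (pi / 2 ^+ p.+1) * autocorr (2 ^ p.+2) g 0.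
Proof.
move=> galt.
have gper k : g (k + 2 ^ p.+2)%N = g k.
  by rewrite [(2 ^ p.+2)%N]expnS mul2n -addnn addnA !galt opprK.
suff le i : (i <= p)%N -> autocorr (2 ^ p.+2) g (2 ^ (p - i)) <=
    cos (pi / 2 ^+ i.+1) * autocorr (2 ^ p.+2) g 0.
  by have := le p (leqnn p); rewrite subnn.
elim: i => [_|i IHi ip].
  rewrite subn0 expr1 cos_pihalf mul0r.
  set r := autocorr _ _ _; suff : r = - r by lra.
  rewrite {1}/r /autocorr.
  rewrite -(@periodic_sum _ (2 ^ p) (fun k => dotv H (g (k + 2 ^ p)%N) (g k))).
    rewrite /r /autocorr -sumrN; apply: eq_bigr => k _.
    by rewrite -addnA addnn -mul2n -expnS galt dotvNl dotvC.
  by move=> k; rewrite addnAC !gper.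
(* With [t = cos (pi / 2 ^+ i.+2)] the induction hypothesis bounds the doubled shift by
   [(2 t^2 - 1) r0], where [r0] is the autocorrelation at 0. The right side becomes [4 t^2 r0], and
   [4 t > 0] cancels. *)
have := autocorr_double (2 ^ (p - i.+1)) (cos (pi / 2 ^+ i.+2)) gper.
rewrite addnn -mul2n -expnS subnSK// => /le_trans/(_ (lerD (lexx _) (IHi (ltnW ip)))).
rewrite (cos_pi_exp2_double i.+1) => le4.
have c0 := cos_pi_exp2_gt0 i.
rewrite -(ler_pM2l (_ : 0 < 4 * cos (pi / 2 ^+ i.+2 : R))) ?mulr_gt0//.
lra.
Qed.

(** The half-period differences [g] change sign after half a period, so [autocorr_alternating]
    applies to them. Moreover [2 r0 - 2 r1], with [r0] and [r1] the autocorrelations at 0 and 1, is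
    the sum of [|g (k + 1) - g k|^2], which [|u - v|^2 <= 2 |u|^2 + 2 |v|^2] and periodicity bound
    by four times the sum of squared steps of [F]. *)
Lemma cyclic_antipodal_le p (F : nat -> H) :
  (forall k, F (k + 2 ^ p.+2)%N = F k) ->
  (1 - cos (pi / 2 ^+ p.+1)) *
    \sum_(0 <= k < 2 ^ p.+2) `|F (k + 2 ^ p.+1)%N - F k| ^+ 2 <=
  2 * \sum_(0 <= k < 2 ^ p.+2) `|F k.+1 - F k| ^+ 2.
Proof.
move=> Fper; set n := (2 ^ p.+2)%N; set m := (2 ^ p.+1)%N.
have nE : n = (m + m)%N by rewrite addnn -mul2n -expnS.
pose g k := F (k + m)%N - F k.
have galt k : g (k + m)%N = - g k by rewrite /g -addnA -nE Fper opprB.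
have gper k : g (k + n)%N = g k by rewrite nE addnA !galt opprK.
have := autocorr_alternating galt; rewrite -/n.
have r0E : autocorr n g 0 = \sum_(0 <= k < n) `|F (k + m)%N - F k| ^+ 2.
  by apply: eq_bigr => k _; rewrite addn0 dotvE.
have step : 2 * autocorr n g 0 - 2 * autocorr n g 1 <=
    4 * \sum_(0 <= k < n) `|F k.+1 - F k| ^+ 2.
  have gg i : \sum_(0 <= k < n) `|g (k + i)%N| ^+ 2 = autocorr n g 0.
    rewrite (@periodic_sum _ _ (fun k => `|g k| ^+ 2)) => [|k]; last by rewrite gper.
    by apply: eq_bigr => k _; rewrite addn0 dotvE.
  have -> : 2 * autocorr n g 0 - 2 * autocorr n g 1 =
      \sum_(0 <= k < n) `|g k.+1 - g k| ^+ 2.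
    rewrite mulr_natl mulr2n -{1}(gg 1%N) -(gg 0%N) /autocorr big_distrr -big_split/=.
    rewrite -sumrB; apply: eq_bigr => k _; rewrite addn0 addn1 -!dotvE.
    move: (g k.+1) (g k) => a b.
    by rewrite dotvDl !dotvDr !dotvNl !dotvNr (dotvC a b)/=; ring.
  pose d k := `|F k.+1 - F k| ^+ 2.
  have dE : \sum_(0 <= k < n) d (k + m)%N = \sum_(0 <= k < n) d k.
    by apply: periodic_sum => k; rewrite /d -addSn !Fper.
  apply: (@le_trans _ _ (\sum_(0 <= k < n) (2 * d (k + m)%N + 2 * d k))).
    apply: ler_sum => k _.
    have -> : g k.+1 - g k = (F (k + m).+1 - F (k + m)%N) - (F k.+1 - F k).
      by rewrite /g addSn !opprB addrACA [RHS]addrAC -!addrA; congr (_ + _);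
         rewrite addrCA; congr (_ + _); rewrite addrC.
    rewrite /d; move: (F _ - _) (F k.+1 - _) => u v.
    have : 0 <= `|u + v| ^+ 2 by exact: sqr_ge0.
    rewrite -!dotvE !dotvDl !dotvDr !dotvNl !dotvNr; lra.
  rewrite big_split/= -!big_distrr/= dE; lra.
rewrite -r0E; lra.
Qed.

End CyclicSums.

(** * Lower bound on the distortion *)

Lemma orthonormal_pair (C : numClosedFieldType)
    (V : hilbertType (@Num.conj C)) : dim_geq V 2 ->
  exists u v : V, [/\ dotv V u u = 1, dotv V v v = 1 & dotv V u v = 0].
Proof.
move=> [e free_e].
have normalize (x : V) : x != 0 -> `|(`|x|^-1 : C) *: x| = 1.
  by move=> x0; rewrite normrZ normfV normr_id mulVf// normr_eq0.
have indep (a b : C) : a *: e ord0 + b *: e ord_max = 0 -> a = 0 /\ b = 0.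
  move=> ab0; pose c (i : 'I_2) := if i == ord0 then a else b.
  have c0 : \sum_i c i *: e i = 0.
    rewrite big_ord_recl big_ord1 -[RHS]ab0 /c/=.
    by rewrite (_ : lift ord0 ord0 = ord_max)//; apply: val_inj.
  by split; [have := free_e c c0 ord0|have := free_e c c0 ord_max].
have e0 : e ord0 != 0.
  apply/eqP => e0; have [] := indep 1 0; first by rewrite scale1r e0 scale0r addr0.
  by move/eqP; rewrite oner_eq0.
pose u := (Num.norm (e ord0))^-1 *: e ord0; have u1 := normalize _ e0.
have uu : dotv V u u = 1 by rewrite dotvE u1 expr1n.
pose w := ortho_part u (e ord_max).
have w0 : w != 0.
  apply/eqP => w0.
  have [] := indep (- dotv V (e ord_max) u * (Num.norm (e ord0))^-1) 1.
    by rewrite -scalerA scale1r addrC scaleNr.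
  by move=> _ /eqP; rewrite oner_eq0.
exists u, ((Num.norm w)^-1 *: w); split => //.
  by rewrite dotvE normalize// expr1n.
rewrite dotvZr [dotv V u w]dotvC /w /ortho_part dotvDl dotvNl dotvZl uu.
by rewrite mulr1 subrr conjC0 mulr0.
Qed.

(** * A great circle and its image in the quotient *)

Section GreatCircle.
Context {R : realType} (V : complex_hilbertType R) (u v : V).
Context (uu : dotv V u u = 1) (vv : dotv V v v = 1) (uv : dotv V u v = 0).

Definition great_circle (t : R) : V := (cos t)%:C%C *: u + (sin t)%:C%C *: v.

Lemma great_circle_dot (s t : R) :
  dotv V (great_circle s) (great_circle t) = (cos (s - t))%:C%C.
Proof.
have vu : dotv V v u = 0 by rewrite dotvC uv conjC0.
have creal (r : R) : (r%:C%C : R[i])^* = r%:C%C.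
  by apply/CrealP; rewrite complex_real.
rewrite /great_circle !dotvDl !dotvDr !dotvZl !dotvZr uu vv uv vu !creal.
by rewrite !mulr0 addr0 add0r !mulr1 -!rmorphM -rmorphD cosB.
Qed.

Lemma great_circle_dist (s t : R) :
  mdist (circle_class (great_circle s)) (circle_class (great_circle t)) ^+ 2 =
  2 - 2 * `|cos (s - t)|.
Proof.
rewrite circle_mdistE -/(rotation_dist _ _) rotation_dist_sqr.
rewrite -!absdotxx /absdot !great_circle_dot !subrr cos0 !normc_def/=.
by rewrite !expr0n/= !addr0 !sqrtr_sqr normr1; lra.
Qed.

(** Half a turn is multiplication by -1, an element of the group; hence [n] steps of [pi / n]
    already close the cycle. *)
Lemma great_circle_antipode (t : R) :
  circle_class (great_circle (t + pi)) = circle_class (great_circle t).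
Proof.
apply/circle_classP; exists (-1); first by rewrite normrN1.
by rewrite scaleN1r /great_circle cosDpi sinDpi !rmorphN/= !scaleNr -opprD opprK.
Qed.

End GreatCircle.

(** The lower Lipschitz bound is used on half-period pairs and the upper one on consecutive pairs;
    [cyclic_antipodal_le] compares the two sums. *)
Lemma distortion_ge_cos (R : realType) (V : complex_hilbertType R)
    (H : real_hilbertType R) (f : circle_quotient V -> H)
    (c alpha : R) (p : nat) :
  dim_geq V 2 -> 0 < alpha -> 0 <= c ->
  (forall X Y, alpha * mdist X Y <= `|f X - f Y| /\
               `|f X - f Y| <= c * alpha * mdist X Y) ->
  1 + cos (pi / 2 ^+ p.+2) <= c ^+ 2.
Proof.
move=> /orthonormal_pair[u [v [uu vv uv]]] a0 c0 fb.
set n := (2 ^ p.+2)%N; set b : R := pi / 2 ^+ p.+2.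
pose x k := circle_class (great_circle u v (k%:R * b)).
pose F k := f (x k).
have nb : n%:R * b = pi by rewrite /n /b natrX mulrC divfK// expf_neq0.
have n0 : 0 < n%:R :> R by rewrite ltr0n expn_gt0.
have Fper k : F (k + n)%N = F k.
  by rewrite /F /x natrD mulrDl nb great_circle_antipode.
have cosb0 : 0 < cos b := cos_pi_exp2_gt0 p.
have upper k : `|F k.+1 - F k| ^+ 2 <= (c * alpha) ^+ 2 * (2 - 2 * cos b).
  have [_] := fb (x k.+1) (x k).
  rewrite -(@ler_pXn2r _ 2) ?nnegrE ?mulr_ge0 ?mdist_ge0 ?(ltW a0)//.
  move/le_trans; apply; rewrite exprMn great_circle_dist//.
  have -> : k.+1%:R * b - k%:R * b = b by rewrite -natr1; ring.
  by rewrite (ger0_norm (ltW cosb0)).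
have lower k : alpha ^+ 2 * 2 <= `|F (k + 2 ^ p.+1)%N - F k| ^+ 2.
  have [+ _] := fb (x (k + 2 ^ p.+1)%N) (x k).
  rewrite -(@ler_pXn2r _ 2) ?nnegrE ?mulr_ge0 ?mdist_ge0 ?(ltW a0)//.
  apply: le_trans; rewrite exprMn great_circle_dist//.
  have -> : (k + 2 ^ p.+1)%:R * b - k%:R * b = pi / 2.
    rewrite natrD mulrDl addrAC subrr add0r /b natrX [in RHS]mulrC.
    by rewrite [2 ^+ p.+2]exprS; field; rewrite expf_neq0.
  by rewrite cos_pihalf normr0 mulr0 subr0.
have := cyclic_antipodal_le Fper; rewrite -/n (cos_pi_exp2_double p.+1) -/b.
(* Strictness makes the common factor [1 - cos b] cancellable at the end. *)
have cosb1 : cos b < 1.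
  have pow1 : 1 < 2 ^+ p.+2 :> R by rewrite exprn_egt1 ?ltr1n.
  have b_gt0 : 0 < b by rewrite divr_gt0 ?pi_gt0// (lt_trans ltr01).
  have b_le : b <= pi.
    by rewrite ler_pdivrMr ?(lt_trans ltr01)// ler_pMr ?pi_gt0// ltW.
  by rewrite -[ltRHS]cos0 ltr_cos// in_itv/= ?lexx ?pi_ge0// ltW.
have sumu : \sum_(0 <= k < n) `|F k.+1 - F k| ^+ 2 <=
    n%:R * ((c * alpha) ^+ 2 * (2 - 2 * cos b)).
  rewrite mulr_natl -[in leRHS](subn0 n) -sumr_const_nat.
  by apply: ler_sum => k _; exact: upper.
have suml : n%:R * (alpha ^+ 2 * 2) <=
    \sum_(0 <= k < n) `|F (k + 2 ^ p.+1)%N - F k| ^+ 2.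
  rewrite mulr_natl -[in leLHS](subn0 n) -sumr_const_nat.
  by apply: ler_sum => k _; exact: lower.
have cosb_sub : 0 < 1 - cos b by rewrite subr_gt0.
(* One factor [1 - cos b] also occurs in the squared consecutive distance [2 - 2 cos b]; after
   cancellation [1 + cos b] remains against [c ^+ 2]. *)
have cos2 : 1 - (2 * cos b ^+ 2 - 1) = 2 * (1 - cos b) * (1 + cos b) by ring.
rewrite cos2.
have w0 : 0 <= 2 * (1 - cos b) * (1 + cos b).
  by rewrite mulr_ge0 ?mulr_ge0 ?(ltW cosb_sub)// addr_ge0// ltW.
move=> /(le_trans (ler_wpM2l w0 suml))/le_trans.
move=> /(_ _ (ler_wpM2l (ler0n _ 2) sumu)).
have -> : 2 * (1 - cos b) * (1 + cos b) * (n%:R * (alpha ^+ 2 * 2)) =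
  (4 * (1 - cos b) * n%:R * alpha ^+ 2) * (1 + cos b) by ring.
have -> : 2 * (n%:R * ((c * alpha) ^+ 2 * (2 - 2 * cos b))) =
  (4 * (1 - cos b) * n%:R * alpha ^+ 2) * c ^+ 2 by ring.
by rewrite ler_pM2l// !mulr_gt0// exprn_gt0.
Qed.

Lemma cos_pi_exp2_cvg (R : realType) :
  1 + cos (pi / 2 ^+ p.+2 : R) @[p --> \oo] --> (2 : R).
Proof.
have twoE : 2 = 1 + cos 0 :> R by rewrite cos0.
rewrite [X in _ --> X]twoE.
apply: cvgD; first exact: cvg_cst.
suff b0 : pi / 2 ^+ p.+2 @[p --> \oo] --> (0 : R).
  exact: (cvg_comp _ _ b0 (@continuous_cos R 0)).
have -> : (fun p => pi / 2 ^+ p.+2 : R) = geometric (pi / 4) 2^-1.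
  apply/funext => p; rewrite /geometric/= !exprS exprVn; field.
  by rewrite expf_neq0.
by apply: cvg_geometric; rewrite ger0_norm// invf_lt1// ltr1n.
Qed.

Theorem corollary37 (R : realType) (V : complex_hilbertType R)
    (dimV : dim_geq V 2) :
  euclidean_distortion (circle_quotient V) = (Num.sqrt (2 : R))%:E.
Proof.
apply/eqP; rewrite eq_le; apply/andP; split.
  apply: ereal_inf_lbound; exists (Num.sqrt 2) => //; split.
    by rewrite -{1}[1]sqrtr1 ler_wsqrtr// ler1n.
  exists (kernel_hilbert (fs_psd_kernel V)), (@fs_embedding R V), 1.
  by split => // X Y; rewrite mul1r mulr1; exact: fs_embedding_bounds.
apply: le_ereal_inf_tmp => _ [c [c1 [H [f [alpha [a0 fb]]]]] <-].
have c0 : 0 <= c by rewrite (le_trans ler01).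
rewrite lee_fin -(@ler_pXn2r _ 2) ?nnegrE ?sqrtr_ge0// sqr_sqrtr//.
(* The bounds for all [p] pass to the limit [2 <= c ^+ 2]. *)
apply: (cvgr_to_le (@cos_pi_exp2_cvg R)); apply: nearW => p.
exact: distortion_ge_cos fb.
Qed.
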